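(* Let $\beta\in(0,d]$, let $Q\subset\mathbb{R}^d$ be a cube, and let $f \in L^1(\mathbb{R}^d;\mathcal{H}^{\beta,Q}_\infty)$ be non-negative. Then for $\mathcal{H}^\beta$-a.e. $x\in \mathbb{R}^d$, $$\limsup_{Q' \to x} \frac{1}{l(Q')^\beta} \int_{Q'} f\, d\mathcal{H}^{\beta,Q}_\infty = f(x),$$ where the limit superior is over cubes $Q'\in\mathcal{D}(Q)$ containing $x$ as $l(Q')\to0$.
   Context: For a cube $Q=a+[0,\ell)^d$ (cubes are half-open), $\mathcal{D}(Q)=\{a+2^{-j}\ell(m+[0,1)^d): j\in\mathbb{Z}, m\in\mathbb{Z}^d\}$. $\mathcal{H}^{\beta,Q}_{\infty}(E)= \inf \{\sum_{i} l(Q_i)^\beta : E \subset \bigcup_{i} Q_i,\ Q_i \in \mathcal{D}(Q) \}$, $l(\cdot)$ the side length. For $f\ge0$ and a set $A$, $\int_A f\,d\mathcal{H}^{\beta,Q}_\infty=\int_0^\infty \mathcal{H}^{\beta,Q}_\infty(\{x\in A:f(x)>t\})\,dt$. $f$ is $\mathcal{H}^{\beta,Q}_\infty$-quasicontinuous if for every $\epsilon>0$ there is an open $O$ with $\mathcal{H}^{\beta,Q}_\infty(O)<\epsilon$ and $f|_{O^c}$ continuous; $L^1(\mathbb{R}^d;\mathcal{H}^{\beta,Q}_\infty)$ is the set of such $f$ with $\int_{\mathbb{R}^d}|f|\,d\mathcal{H}^{\beta,Q}_\infty<\infty$. $\mathcal{H}^\beta$ denotes the $\beta$-dimensional Hausdorff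 measure. *)

(* Defs.v *)
From HB Require Import structures.
From mathcomp Require Import all_boot all_order all_algebra.
From mathcomp Require Import all_classical all_reals all_analysis.
Set Implicit Arguments. Unset Strict Implicit. Unset Printing Implicit Defensive.
Import Order.TTheory GRing.Theory Num.Theory.
Import numFieldNormedType.Exports.
Local Open Scope classical_set_scope.
Local Open Scope ring_scope.

Section Defs.
Variables (R : realType) (d : nat).
Local Notation V := 'rV[R]_d.

(* The reference cube Q = a + [0,l)^d is given by its corner a and side l. *)
Definition dside (l : R) (j : int) : R := (2%:R ^ (- j)) * l.

Definition dcube (a : V) (l : R) (j : int) (m : 'I_d -> int) : set V :=
  [set x | forall i : 'I_d,
     a ord0 i + dside l j * (m i)%:~R <= x ord0 i /\
     x ord0 i < a ord0 i + dside l j * ((m i)%:~R + 1)].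

(* Dyadic Hausdorff content H^{beta,Q}_infty: countable (or finite, via None)
   covers by cubes of D(Q). *)
Definition dcover (a : V) (l : R) (c : option (int * ('I_d -> int))) : set V :=
  if c is Some p then dcube a l p.1 p.2 else set0.
Definition dcost (beta l : R) (c : option (int * ('I_d -> int))) : \bar R :=
  if c is Some p then ((dside l p.1) `^ beta)%:E else 0%E.

Definition content (beta : R) (a : V) (l : R) (E : set V) : \bar R :=
  ereal_inf [set s | exists c : nat -> option (int * ('I_d -> int)),
    E `<=` \bigcup_i dcover a l (c i) /\
    s = (\sum_(0 <= i <oo) dcost beta l (c i))%E].

Definition choquet (beta : R) (a : V) (l : R) (A : set V) (f : V -> R) : \bar R :=
  (\int[(@lebesgue_measure R)]_(t in `[0%R, +oo[%classic)
      content beta a l [set x | A x /\ (t < f x)%R])%E.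

Definition quasicont (beta : R) (a : V) (l : R) (f : V -> R) : Prop :=
  forall eps : R, 0 < eps -> exists O : set V,
    open O /\ (content beta a l O < eps%:E)%E /\ {within ~` O, continuous f}.

Definition L1content (beta : R) (a : V) (l : R) (f : V -> R) : Prop :=
  quasicont beta a l f /\
  (choquet beta a l setT (fun x => (`|f x|)%R) < +oo)%E.

(* beta-dimensional Hausdorff (outer) measure, without normalising constant *)
Definition diam (U : set V) : R := sup [set r | exists x y, U x /\ U y /\ r = `|x - y|].

Definition hausdorff_delta (beta delta : R) (E : set V) : \bar R :=
  ereal_inf [set s | exists U : nat -> set V,
    E `<=` \bigcup_i U i /\
    (forall i x y, U i x -> U i y -> `|x - y| <= delta) /\
    s = (\sum_(0 <= i <oo) ((diam (U i)) `^ beta)%:E)%E].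

Definition hausdorff (beta : R) (E : set V) : \bar R :=
  ereal_sup [set hausdorff_delta beta delta E | delta in [set delta | 0 < delta]].

Definition dyadic_limsup (beta : R) (a : V) (l : R) (f : V -> R) (x : V) : \bar R :=
  ereal_inf [set s | exists delta : R, 0 < delta /\
    s = ereal_sup [set v | exists (j : int) (m : 'I_d -> int),
          dcube a l j m x /\ dside l j < delta /\
          v = (((dside l j `^ beta)^-1)%:E * choquet beta a l (dcube a l j m) f)%E]].

End Defs.

(* Main.v *)
(* Write H for the dyadic content and l for the side length.  Since f is integrable,
   the series of the H{f > k} converges; together with quasicontinuity this gives
   an open U off which f is continuous and a K such that the sets E_k := U (k < K),
   E_k := {f > k} (k >= K) have contents summing to less than sigma.  Cover them
   by dyadic cubes P_i with sum_i l(P_i)^beta < sigma, and call a dyadic cube Q'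
   heavy if sum_(P_i in Q') l(P_i)^beta > lam * l(Q')^beta.  The maximal heavy cubes
   are disjoint, so the union B of all heavy cubes has H(B) <= sigma / lam; no
   subadditivity of the Choquet integral is needed.  If x is not in B, then x is in
   no P_i, so by nestedness any Q' containing x satisfies
   sum_k H(Q' & E_k) <= lam * l(Q')^beta, and slicing the Choquet integral at
   integer heights gives, for Q' small,
     (f x - lam) * (1 - lam) <= l(Q')^(-beta) * int_Q' f dH <= f x + 2 * lam.
   The lower bound uses H(Q') = l(Q')^beta, the only place where beta <= d matters. *)
Require Import Defs.
From HB Require Import structures.
From mathcomp Require Import all_boot all_order all_algebra.
From mathcomp Require Import all_classical all_reals all_analysis.
From mathcomp Require Import measurable_realfun lra ring zify.
Import Order.TTheory GRing.Theory Num.Theory.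
Local Open Scope classical_set_scope.
Local Open Scope ring_scope.
Set Implicit Arguments.
Unset Strict Implicit.

(** * Dyadic cubes: sides, nestedness, uniqueness within a level *)

Section Geometry.
Variables (R : realType) (d : nat) (a : 'rV[R]_d) (l : R).
Hypothesis l_gt0 : 0 < l.

Local Notation cube := (dcube a l).

Lemma dside_gt0 j : 0 < dside l j.
Proof. by rewrite /dside mulr_gt0// exprz_gt0. Qed.

Lemma dsideD j (n : nat) : dside l j = 2 ^+ n * dside l (j + n%:Z).
Proof.
by rewrite /dside mulrA exprnP -expfzDr// opprD addrCA subrr addr0.
Qed.

Lemma dside_small e : 0 < e -> exists j, dside l j < e.
Proof.
move=> e0; have [n ltn] : exists n : nat, l / e < n%:R.
  by exists (Num.truncn (l / e)).+1; exact: Num.Theory.truncnS_gt.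
exists n%:Z; rewrite /dside -invr_expz -exprnP ltr_pdivrMl ?exprn_gt0//.
rewrite ltr_pdivrMr// in ltn; apply: (lt_le_trans ltn).
rewrite ler_wpM2r ?(ltW e0)// -natrX ler_nat; exact/ltnW/ltn_expl.
Qed.

Lemma dside_anti j j' : j <= j' -> dside l j' <= dside l j.
Proof.
move=> jj'; rewrite (dsideD j `|j' - j|%N) gez0_abs ?subr_ge0//.
rewrite (addrC j) subrK ler_peMl ?(ltW (dside_gt0 _))//.
by rewrite exprn_ege1// ler1n.
Qed.

Lemma dside_large M : exists j0, forall j, j <= j0 -> M < dside l j.
Proof.
have [n ltn] : exists n : nat, M / l < n%:R.
  by exists (Num.truncn (M / l)).+1; exact: Num.Theory.truncnS_gt.
exists (- n%:Z) => j /dside_anti; apply: lt_le_trans.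
rewrite /dside opprK -exprnP; rewrite ltr_pdivrMr// in ltn.
apply: (lt_le_trans ltn); rewrite ler_wpM2r ?(ltW l_gt0)// -natrX ler_nat.
exact/ltnW/ltn_expl.
Qed.

Lemma dcube_exists x j : exists m, cube j m x.
Proof.
have s0 := dside_gt0 j.
exists (fun i => Num.floor ((x ord0 i - a ord0 i) / dside l j)) => i.
have /andP[] := floor_itv ((x ord0 i - a ord0 i) / dside l j).
rewrite ler_pdivlMr// ltr_pdivrMr// intrD mulr1z => h1 h2.
by split; [move: h1; lra|move: h2; lra].
Qed.

Lemma dcube_corner j m : cube j m (\row_i (a ord0 i + dside l j * (m i)%:~R)).
Proof. by move=> i; rewrite mxE lexx; split=> //; have := dside_gt0 j; lra. Qed.

(** Measured in the finer side, the common point [x] gives strict inequalities between integers,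
    which sharpen to [N * m i <= m' i] and [m' i + 1 <= N * (m i + 1)], [N] being the ratio of the
    sides. *)
Lemma dcube_nested j m j' m' x : j <= j' -> cube j m x -> cube j' m' x ->
  cube j' m' `<=` cube j m.
Proof.
move=> jj' cx cx' y cy i; have [n j'E] : exists n : nat, j' = j + n%:Z.
  by exists `|j' - j|%N; rewrite gez0_abs; lia.
have sE := dsideD j n; rewrite -j'E in sE.
have s0 := dside_gt0 j'.
have [+ +] := cx i; have [+ +] := cx' i; have [+ +] := cy i.
rewrite sE; set s := dside l j' in s0 *.
have -> : 2 ^+ n = (2 ^ n)%N%:Z%:~R :> R by rewrite -pmulrn natrX.
set N := (2 ^ n)%N%:Z => y1 y2 x1' x2' x1 x2.
have h1 : (N * m i < m' i + 1)%R.
  rewrite -(ltr_int R) -(ltr_pM2l s0) intrM intrD mulr1z; lra.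
have h2 : (m' i < N * (m i + 1))%R.
  rewrite -(ltr_int R) -(ltr_pM2l s0) intrM intrD mulr1z; lra.
have h3 : (N * m i <= m' i)%R by lia.
have h4 : (m' i + 1 <= N * (m i + 1))%R by lia.
move: h3; rewrite -(ler_int R) -(ler_pM2l s0) intrM => h3.
move: h4; rewrite -(ler_int R) -(ler_pM2l s0) intrM !intrD mulr1z => h4.
split; lra.
Qed.

Lemma dcube_index j m m' x : cube j m x -> cube j m' x -> m = m'.
Proof.
move=> cx cx'; apply/funext => i; have s0 := dside_gt0 j.
have [x1 x2] := cx i; have [x1' x2'] := cx' i.
have h1 : (m i < m' i + 1)%R.
  rewrite -(ltr_int R) -(ltr_pM2l s0) intrD mulr1z; lra.
have h2 : (m' i < m i + 1)%R.
  rewrite -(ltr_int R) -(ltr_pM2l s0) intrD mulr1z; lra.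
lia.
Qed.

(** The norm on row vectors is the sup norm, so no dimensional constant appears. *)
Lemma dcube_dist j m x y : cube j m x -> cube j m y -> `|x - y| <= dside l j.
Proof.
move=> cx cy; have s0 := dside_gt0 j.
rewrite /Num.norm/= mx_normrE; apply: bigmax_le => [|[i0 i] _]; first exact: ltW.
rewrite !mxE/= (ord1 i0).
have [x1 x2] := cx i; have [y1 y2] := cy i.
rewrite ler_norml; apply/andP; split; lra.
Qed.

End Geometry.

(** * Dyadic content: covers and countable subadditivity *)

Section Content.
Variables (R : realType) (d : nat) (beta : R) (a : 'rV[R]_d) (l : R).

Local Notation H := (Defs.content beta a l).
Local Notation index := (option (int * ('I_d -> int))).
Local Notation cover := (@dcover R d a l).
Local Notation cost := (@dcost R d beta l).
Local Open Scope ereal_scope.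

Lemma dcost_ge0 (c : index) : 0 <= cost c.
Proof. by case: c => [p|]//=; rewrite lee_fin powR_ge0. Qed.

(** A countable index type is turned into a sequence by [pickle]; naturals outside its range get
    [None], which is empty and costs 0. *)
Lemma dcontent_le_esum (I : countType) (P : I -> index) E :
  E `<=` \bigcup_i cover (P i) -> H E <= \esum_(i in [set: I]) cost (P i).
Proof.
move=> EP; pose c n := obind P (pickle_inv n).
have cE i : c (pickle i) = P i by rewrite /c pickleK_inv.
apply: ereal_inf_lbound; exists c; split.
  by move=> x /EP[i _ Pix]; exists (pickle i) => //; rewrite cE.
rewrite nneseries_esumT; last by move=> n; exact: dcost_ge0.
transitivity (\esum_(i in range (@pickle I)) cost (c i)).
  rewrite esum_image; first by apply: eq_esum => i _; rewrite cE.
  by move=> i j _ _; exact: (pcan_inj pickleK).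
rewrite esum_mkcond; apply: eq_esum => n _; case: ifPn => //.
rewrite notin_setE => nP; rewrite /c; case E1: (pickle_inv n) => [i|]//=.
exfalso; apply: nP; exists i => //.
by have := @pickle_invK I n; rewrite /ocancel E1/=.
Qed.

Lemma dcontent_ge0 E : 0 <= H E.
Proof.
apply/ereal_infP => _ [c [_ ->]]; apply: nneseries_ge0 => n _ _.
exact: dcost_ge0.
Qed.

Lemma le_dcontent A B : A `<=` B -> H A <= H B.
Proof.
move=> AB; apply: ereal_inf_le_tmp => _ [c [Bc ->]]; exists c; split => //.
exact: subset_trans Bc.
Qed.

Lemma dcontent_dcube_le j m : H (dcube a l j m) <= ((dside l j) `^ beta)%:E.
Proof.
apply: le_trans (@dcontent_le_esum unit (fun=> Some (j, m)) _ _) _.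
  by move=> x cx; exists tt.
rewrite (_ : [set: unit] = [set tt]) ?esum_set1//.
  by rewrite lee_fin powR_ge0.
by apply/seteqP; split => // -[].
Qed.

(** Near-optimal covers of the single [E k] are joined, their errors summing to [e]. Keeping [k] in
    the index allows each [E k] to be treated separately later. *)
Lemma dcontent_covers (E : nat -> set 'rV[R]_d) (s : R) :
  \sum_(k <oo) H (E k) < s%:E ->
  exists P : nat * nat -> index,
    (forall k, E k `<=` \bigcup_i cover (P (k, i))) /\
    \esum_(p in [set: nat * nat]) cost (P p) < s%:E.
Proof.
move=> Es; have E0 k : 0 <= H (E k) by exact: dcontent_ge0.
have S0 : 0 <= \sum_(k <oo) H (E k) by exact: nneseries_ge0.
have Sfin : \sum_(k <oo) H (E k) \is a fin_num.
  by rewrite ge0_fin_numE// (lt_trans Es)// ltry.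
(* Half of the slack, so that the total cost stays strictly below [s]. *)
pose e := ((s - fine (\sum_(k <oo) H (E k))) / 2)%R.
have e0 : (0 < e)%R.
  by rewrite divr_gt0// subr_gt0 -lte_fin fineK.
have ex k : exists c : nat -> index, E k `<=` \bigcup_i cover (c i) /\
    \esum_(i in [set: nat]) cost (c i) <= H (E k) + (e / (2 ^ k.+1)%:R)%:E.
  have Hfin : H (E k) \is a fin_num.
    rewrite ge0_fin_numE//; apply: (@le_lt_trans _ _ (\sum_(k <oo) H (E k))).
      rewrite (@nneseriesD1 _ _ k)// leeDl//; apply: nneseries_ge0 => *; exact: E0.
    by rewrite (lt_trans Es)// ltry.
  have [|_ [c [Ec ->]] clt] := @lb_ereal_inf_adherent R _ (e / (2 ^ k.+1)%:R) _ Hfin.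
    by rewrite divr_gt0// ltr0n expn_gt0.
  exists c; split => //; rewrite -nneseries_esumT; last by move=> n; exact: dcost_ge0.
  exact: ltW.
have [c cP] := choice ex.
exists (fun p => c p.1 p.2); split; first by move=> k; exact: (cP k).1.
apply: (@le_lt_trans _ _ (\sum_(k <oo) H (E k) + e%:E)); last first.
  rewrite -[X in X + _]fineK// -EFinD lte_fin /e.
  move: e0; rewrite /e; lra.
apply: le_trans (epsilon_trick xpredT E0 (ltW e0)).
rewrite nneseries_esumT; last first.
  by move=> n; rewrite adde_ge0// lee_fin divr_ge0// ltW.
rewrite [X in \esum_(p in X) _](_ : _ = [set: nat] `*`` (fun=> [set: nat])); last first.
  by apply/seteqP; split.
rewrite -(@esum_esum R nat nat _ _ (fun i j => cost (c i j))); last first.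
  by move=> i j _ _; exact: dcost_ge0.
by apply: le_esum => k _; exact: (cP k).2.
Qed.

Lemma dcontent_bigcup (E : nat -> set 'rV[R]_d) :
  H (\bigcup_k E k) <= \sum_(k <oo) H (E k).
Proof.
apply/lee_addgt0Pr => e e0.
have S0 : 0 <= \sum_(k <oo) H (E k).
  by apply: nneseries_ge0 => *; exact: dcontent_ge0.
case: (ltP (\sum_(k <oo) H (E k)) +oo) => [Sfin|]; last first.
  by rewrite leye_eq => /eqP ->; rewrite addye// leey.
have Sf : \sum_(k <oo) H (E k) \is a fin_num by rewrite ge0_fin_numE.
have [|P [EP Pe]] := @dcontent_covers E (fine (\sum_(k <oo) H (E k)) + e).
  by rewrite EFinD fineK// lteDl// lte_fin.
apply: (@le_trans _ _ (\esum_(p in [set: nat * nat]) cost (P p))).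
  apply: dcontent_le_esum => x [k _ /EP[i _ Px]]; by exists (k, i).
by rewrite ltW//; move: Pe; rewrite EFinD fineK.
Qed.

Lemma dcontent0 : H set0 = 0.
Proof.
apply/eqP; rewrite eq_le dcontent_ge0 andbT.
apply: le_trans (@dcontent_le_esum unit (fun=> None) _ _) _ => //.
by rewrite esum1.
Qed.

Lemma dcontentU A B : H (A `|` B) <= H A + H B.
Proof.
rewrite -bigcup2E; apply: le_trans (dcontent_bigcup _) _.
rewrite (@nneseriesD1 _ _ 0%N)//; last by move=> *; exact: dcontent_ge0.
rewrite (@nneseriesD1 _ _ 1%N)//; last by move=> *; exact: dcontent_ge0.
rewrite /= eseries0 ?adde0// => -[|[|n]]//= _ _; exact: dcontent0.
Qed.

End Content.

(** * Volume bound for countable covers of a cube *)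

Section Volume.
Variable R : realType.
Local Open Scope ereal_scope.

Lemma cube_cover_volume (d : nat) (q : 'I_d -> R) (S : R)
    (lo : nat -> 'I_d -> R) (s : nat -> R) :
  (0 < S)%R -> (forall i, 0 <= s i)%R ->
  (forall x : 'I_d -> R, (forall k, x k \in `[q k, q k + S[)%R ->
     exists i, forall k, (x k \in `[lo i k, lo i k + s i[)%R) ->
  (S ^+ d)%:E <= \sum_(i <oo) (s i ^+ d)%:E.
Proof.
move=> S_gt0 s0 cov; have S0 := ltW S_gt0.
pose I i k : set R := [set` `[lo i k, lo i k + s i[%R].
have mI i k : measurable (I i k) by exact: measurable_itv.
pose F k i (x : 'I_d -> R) (j : 'I_d) : R :=
  if (j < k)%N then s i else \1_(I i j) (x j).
have F0 k i x j : (0 <= F k i x j)%R by rewrite /F; case: ifP.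
(* Integrating [1 <= sum_i 1_(I i)] over one coordinate after the other turns
   the indicators into sides; [T k x] is the sum after [k] integrations. *)
pose T k x := \sum_(i <oo) (\prod_j F k i x j)%:E.
suff H k : (k <= d)%N -> forall x, (forall j, x j \in `[q j, q j + S[)%R ->
    (S ^+ k)%:E <= T k x.
  have qx j : (q j \in `[q j, q j + S[)%R.
    by rewrite in_itv/= lexx/= ltrDl.
  apply: le_trans (H d (leqnn _) q qx) _.
  rewrite /T; apply: lee_nneseries => i _; first by rewrite lee_fin prodr_ge0.
  rewrite lee_fin (eq_bigr (fun=> s i)) ?prodr_const ?card_ord//.
  by move=> j _; rewrite /F ltn_ord.
elim: k => [_ x xq|k IH kd x xq].
  (* Before any integration, a cube containing [x] contributes the product 1. *)
  have [i xi] := cov x xq.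
  rewrite expr0 /T (@nneseriesD1 _ _ i)//; last first.
    by move=> n _; rewrite lee_fin prodr_ge0.
  rewrite big1 ?leeDl//; last first.
    by move=> j _; rewrite /F/= indicE mem_set//= /I/=.
  by apply: nneseries_ge0 => n _ _; rewrite lee_fin prodr_ge0.
pose k0 := Ordinal kd.
pose xt t j := if j == k0 then t else x j.
pose J : set R := [set` `[q k0, q k0 + S[%R].
have mJ : measurable J by exact: measurable_itv.
have muJ : lebesgue_measure J = S%:E.
  by rewrite lebesgue_measure_itv/= lte_fin ltrDl S_gt0 -EFinD addrAC subrr add0r.
pose C i : R := (\prod_(j | j != k0) F k i x j)%R.
have C0 i : (0 <= C i)%R by rewrite prodr_ge0.
pose f i : R -> \bar R := fun t => (C i)%:E * (\1_(I i k0) t)%:E.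
have TE t : T k (xt t) = \sum_(i <oo) f i t.
  apply: eq_eseriesr => i _; rewrite /f -EFinM; congr _%:E.
  rewrite (bigD1 k0)//= mulrC /F/= ltnn /xt eqxx; congr (_ * _)%R.
  by apply: eq_bigr => j jk0; rewrite /F (negbTE jk0).
have m1 i : measurable_fun J (fun t : R => (\1_(I i k0) t)%:E : \bar R).
  by apply/measurable_EFinP; exact: measurable_indic.
have mf i : measurable_fun J (f i).
  apply: emeasurable_funM; first exact: measurable_cst.
  exact: m1.
have f0 i t : 0 <= f i t.
  by rewrite mule_ge0// lee_fin.
have : \int[lebesgue_measure]_(t in J) (S ^+ k)%:E <=
       \int[lebesgue_measure]_(t in J) T k (xt t).
  apply: ge0_le_integral => //.
  - by move=> t _; rewrite lee_fin exprn_ge0.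
  - rewrite (_ : (fun t => T k (xt t)) = fun t => \sum_(i <oo) f i t).
      by apply: (@ge0_emeasurable_sum _ _ _ _ f xpredT).
    by apply/funext => t; rewrite TE.
  - move=> t Jt; apply: IH => [|j]; first exact: ltnW.
    by rewrite /xt; case: eqP => [->|].
rewrite integral_cst//= muJ -EFinM -exprSr => /le_trans; apply.
under eq_integral do rewrite TE.
rewrite integral_nneseries//; apply: lee_nneseries => i _.
  by rewrite integral_ge0.
rewrite /f ge0_integralZl_EFin//; last exact: (m1 i).
rewrite integral_indic//; last exact: (mI i k0).
have -> : (\prod_j F k.+1 i x j = C i * s i)%R.
  rewrite (bigD1 k0)//= mulrC /F/= ltnSn; congr (_ * _)%R.
  apply: eq_bigr => j jk0; rewrite ltnS leq_eqVlt.
  by rewrite -val_eqE/= in jk0; rewrite (negbTE jk0).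
rewrite EFinM lee_wpmul2l ?lee_fin//.
(* Cutting [I i k0] down to [J] only decreases its length, which is at most [s i]. *)
apply: (@le_trans _ _ (lebesgue_measure (I i k0))).
  apply: le_measure; rewrite ?inE//; last exact: (mI i k0).
  exact: (measurableI _ _ (mI i k0) mJ).
rewrite lebesgue_measure_itv/= lte_fin ltrDl.
case: ltP => _; last by rewrite lee_fin.
by rewrite -EFinD addrAC subrr add0r.
Qed.

End Volume.

(** * Exact content of a dyadic cube *)

Section ContentCube.
Variables (R : realType) (d : nat) (beta : R) (a : 'rV[R]_d) (l : R).
Hypotheses (beta_gt0 : 0 < beta) (beta_le : beta <= d%:R) (l_gt0 : 0 < l).

Local Notation H := (Defs.content beta a l).
Local Notation index := (option (int * ('I_d -> int))).
Local Open Scope ereal_scope.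

Lemma dcontent_dcube j m : H (dcube a l j m) = ((dside l j) `^ beta)%:E.
Proof.
apply/eqP; rewrite eq_le dcontent_dcube_le/=; apply/ereal_infP => _ [c [cov ->]].
have S0 := dside_gt0 l_gt0 j; set S := dside l j in S0 *.
have c0 i : 0 <= dcost beta l (c i) by exact: dcost_ge0.
pose s i := if c i is Some p then dside l p.1 else 0%R.
have s0 i : (0 <= s i)%R.
  by rewrite /s; case: (c i) => [p|//]; rewrite ltW// dside_gt0.
(* Once all sides are at most [S], [s ^ d <= s `^ beta * S `^ (d - beta)]
   reduces the claim to volumes. *)
have [[i Ss]|/forallNP small] := pselect (exists i, (S <= s i)%R).
  rewrite (@nneseriesD1 _ _ i)//.
  apply: (@le_trans _ _ (dcost beta l (c i))); last first.
    by rewrite leeDl// nneseries_ge0.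
  move: Ss; rewrite /s; case: (c i) => [p|]; last by rewrite leNgt S0.
  by move=> Sp; rewrite lee_fin ge0_ler_powR// ?nnegrE ltW// (lt_le_trans S0).
have sS i : (s i <= S)%R by rewrite leNgt; apply/negP => /ltW; exact: small.
(* Positivity of [d] makes [0 ^+ d] vanish, both for [t = 0] in [powd] and for the [None] terms. *)
have d0 : (0 < d)%N by rewrite -(ltr_nat R) (lt_le_trans beta_gt0).
pose lo i k := if c i is Some p then (a ord0 k + dside l p.1 * (p.2 k)%:~R)%R else 0%R.
have vol : (S ^+ d)%:E <= \sum_(i <oo) (s i ^+ d)%:E.
  apply: (@cube_cover_volume R d (fun k => a ord0 k + S * (m k)%:~R)%R S lo s) => //.
  move=> x xq; pose y : 'rV[R]_d := \row_k x k.
  have /cov[i _] : dcube a l j m y.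
    move=> k; rewrite mxE; have := xq k; rewrite in_itv/= => /andP[x1 x2].
    by split => //; move: x2; rewrite /S; lra.
  case E : (c i) => [p|//] /= yp; exists i => k.
  rewrite /s /lo E in_itv/=; have := yp k; rewrite mxE => -[x1 x2].
  by rewrite x1/=; move: x2; lra.
pose r := (d%:R - beta)%R.
have r0 : (0 <= r)%R by rewrite subr_ge0.
have powd t : (0 <= t)%R -> (t ^+ d = t `^ beta * t `^ r)%R.
  move=> t0; rewrite -powR_mulrn//.
  have [->|tneq0] := eqVneq t 0%R.
    by rewrite [in RHS]powR0 ?gt_eqF// mul0r powR0// pnatr_eq0 -lt0n.
  by rewrite -powRD ?tneq0 ?implybT// /r addrCA subrr addr0.
have Sr0 : (0 < S `^ r)%R by exact: powR_gt0.
rewrite -(@lee_pmul2r _ (S `^ r)%:E)// -EFinM -powd ?(ltW S0)//.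
apply: le_trans vol _.
rewrite muleC -nneseriesZl//; apply: lee_nneseries => i _.
  by rewrite lee_fin exprn_ge0.
have := sS i; have := s0 i; rewrite /s; case: (c i) => [p|] p0 pS.
  rewrite powd// -EFinM lee_fin mulrC ler_wpM2r ?powR_ge0//.
  by rewrite ge0_ler_powR// nnegrE ltW.
by rewrite expr0n gtn_eqF//= mule0.
Qed.

End ContentCube.

(** * Heavy cubes: a weak-type bound for a dyadic maximal function *)

Section MaximalFunction.
Variables (R : realType) (d : nat) (beta : R) (a : 'rV[R]_d) (l : R).
Hypotheses (beta_gt0 : 0 < beta) (l_gt0 : 0 < l).
Variables (I : choiceType) (P : I -> option (int * ('I_d -> int))) (s lam : R).
Hypothesis lam_gt0 : 0 < lam.
Local Open Scope ereal_scope.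

Local Notation cost := (@dcost R d beta l).
Hypothesis P_le : \esum_(p in [set: I]) cost (P p) <= s%:E.

Definition inside j (m : 'I_d -> int) : set I :=
  [set p | exists2 q, P p = Some q & dcube a l q.1 q.2 `<=` dcube a l j m].

Definition heavy j (m : 'I_d -> int) : Prop :=
  (lam * dside l j `^ beta)%:E < \esum_(p in inside j m) cost (P p).

(** The whole family costs at most [s], which bounds the side of a heavy cube; so among the heavy
    cubes around a point there is a coarsest one. *)
Lemma heavy_level_bounded :
  exists j0, forall j m, heavy j m -> (j0 <= j)%R.
Proof.
pose M := (s / lam)%R.
have s0 : (0 <= s)%R.
  rewrite -lee_fin; apply: le_trans P_le; apply: esum_ge0 => p _.
  exact: dcost_ge0.
have M0 : (0 <= M)%R by rewrite divr_ge0// ltW.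
have [j0 large] := dside_large l_gt0 (M `^ beta^-1)%R.
exists j0 => j m hj; rewrite leNgt; apply/negP => jj0.
have := large j (ltW jj0); move=> /(gt0_ltr_powR beta_gt0).
rewrite !nnegrE powR_ge0 (ltW (dside_gt0 l_gt0 j)) => /(_ isT isT).
rewrite -powRrM mulVf ?gt_eqF// powRr1// /M ltr_pdivrMr// mulrC.
apply/negP; rewrite -leNgt -lee_fin ltW//; apply: lt_le_trans hj _.
apply: le_trans P_le; rewrite esum_mkcond; apply: le_esum => p _.
by case: ifP => // _; exact: dcost_ge0.
Qed.

(* The maximal heavy cubes are pairwise disjoint, so that the sums over the
   cubes of the family inside them add up to at most the total [s]. *)
Lemma dcontent_heavy :
  Defs.content beta a l [set x | exists j m, dcube a l j m x /\ heavy j m]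
    <= (s / lam)%:E.
Proof.
(* Finite functions replace ['I_d -> int] so that the cubes form a countable type. *)
pose T : countType := (int * {ffun 'I_d -> int})%type.
pose maxl (t : T) := heavy t.1 t.2 /\
  forall j m, (j < t.1)%R -> dcube a l t.1 t.2 `<=` dcube a l j m -> ~ heavy j m.
pose c (t : T) := if pselect (maxl t) then Some (t.1, t.2 : 'I_d -> int) else None.
have [j0 hj0] := heavy_level_bounded.
apply: (@le_trans _ _ (\esum_(t in [set: T]) cost (c t))).
  apply: dcontent_le_esum => x [j [m [xjm hjm]]].
  (* The least such [n] gives the coarsest level at which a heavy cube contains [x]. *)
  pose B n := `[< exists m, dcube a l (j0 + n%:Z)%R m x /\ heavy (j0 + n%:Z)%R m >].
  have exB : exists n, B n.
    exists `|j - j0|%N; apply/asboolP; exists m.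
    by rewrite gez0_abs ?subr_ge0 ?(hj0 _ _ hjm)// (addrC j0) subrK.
  have [n /asboolP[m' [xm' hm']] nmin] := ex_minnP exB.
  have m'E : finfun m' = m' :> ('I_d -> int) by apply/funext => k; rewrite ffunE.
  exists ((j0 + n%:Z)%R, finfun m') => //; rewrite /c.
  case: pselect => [_|nmax] /=; first by rewrite m'E.
  exfalso; apply: nmax; rewrite /maxl/= m'E; split => // j2 m2 j2lt sub hj2.
  have := hj0 _ _ hj2 => j0j2.
  have := nmin `|j2 - j0|%N.
  rewrite /B gez0_abs ?subr_ge0// (addrC j0) subrK.
  suff -> : `[< exists m3, dcube a l j2 m3 x /\ heavy j2 m3 >] by move=> /(_ isT); lia.
  by apply/asboolP; exists m2; split => //; exact: sub.
pose S : set T := [set t | maxl t].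
pose K := S `*`` (fun t : T => inside t.1 t.2).
have cE : \esum_(t in [set: T]) cost (c t) =
    \esum_(t in S) (dside l t.1 `^ beta)%:E.
  rewrite [RHS]esum_mkcond; apply: eq_esum => t _; rewrite /c.
  case: pselect => [tS|tS] /=; first by rewrite mem_set.
  by rewrite memNset.
(* A family cube inside two maximal heavy cubes puts its corner in both; these are then nested, and
   maximality makes them equal. *)
have Kinj : set_inj K snd.
  move=> [t p] [t' p']; rewrite !inE => -[/= tS [q Pq qt]] [/= tS' [q' Pq' qt']] /= pp'.
  move: Pq'; rewrite -pp' Pq => -[qq']; rewrite -{}qq' in qt' *; congr pair.
  have x0 := dcube_corner a l_gt0 q.1 q.2.
  set x := (X in dcube _ _ _ _ X) in x0.
  have xt := qt _ x0; have xt' := qt' _ x0.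
  case: (ltgtP t.1 t'.1) => tt'.
  - exfalso; apply: (tS'.2 t.1 t.2 tt' _ tS.1).
    exact: (dcube_nested l_gt0 (ltW tt') xt xt').
  - exfalso; apply: (tS.2 t'.1 t'.2 tt' _ tS'.1).
    exact: (dcube_nested l_gt0 (ltW tt') xt' xt).
  - case: t t' tt' xt xt' {tS tS' qt qt'} => [j m] [j' m'] /= <- xt xt'.
    congr pair; apply/ffunP => k.
    by rewrite (dcube_index l_gt0 xt xt').
rewrite cE.
have tot : \esum_(t in S) \esum_(p in inside t.1 t.2) cost (P p) <= s%:E.
  rewrite esum_esum; last by move=> *; exact: dcost_ge0.
  rewrite -(esum_image K snd (fun p => cost (P p)))//.
  apply: le_trans P_le; rewrite esum_mkcond; apply: le_esum => p _.
  by case: ifP => // _; exact: dcost_ge0.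
(* An [esum] is a supremum over finite sets; on these the factor [lam] can be moved inside. *)
apply: ge_ereal_sup => _ [X [finX XS] <-].
rewrite EFinM lee_pdivlMr// muleC ge0_mule_fsumr; last first.
  by move=> t; rewrite lee_fin powR_ge0.
apply: le_trans tot; apply: esum_ge; exists X => //.
by apply: lee_fsum => // t /XS[ht _]; rewrite -EFinM ltW.
Qed.

End MaximalFunction.

(* Otherwise [/=] unfolds the content inside integrals. *)
Arguments Defs.content : simpl never.

(** * Monotone functions, and slicing the half-line at integer heights *)

Section UnitIntervals.
Variable R : realType.

(** Preimages of open upper rays are intervals. *)
Lemma nonincreasing_emeasurable (D : set R) (h : R -> \bar R) :
  measurable D -> {homo h : x y / (x <= y)%R >-> (y <= x)%E} ->
  measurable_fun D h.
Proof.
move=> mD h_ni; apply: (measurability _ (ErealGenOInfty.measurableE R)) => //.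
move=> /= _ [_ [r ->]] <-; apply: measurableI => //.
apply: is_interval_measurable => s t /=.
rewrite !in_itv/= !andbT => fs ft u /andP[su ut].
by rewrite in_itv/= andbT (lt_le_trans ft)// h_ni.
Qed.

(** The cutoff at [c] lets an integral be split at a real height and still be sliced at integers. *)
Definition unit_itv (c : R) (k : nat) : set R :=
  `[k%:R, k.+1%:R[%classic `&` `[c, +oo[%classic.

Lemma measurable_unit_itv c k : measurable (unit_itv c k).
Proof. by apply: measurableI; exact: measurable_itv. Qed.

Lemma bigcup_unit_itv c : 0 <= c -> \bigcup_k unit_itv c k = `[c, +oo[%classic.
Proof.
move=> c0; apply/seteqP; split => [t [k _ []]//|t ct].
exists (Num.truncn t) => //; split => //=; rewrite in_itv/=.
apply: Num.Theory.truncn_itv; apply: le_trans c0 _.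
by move: ct; rewrite /= in_itv/= andbT.
Qed.

Lemma trivIset_unit_itv c : trivIset setT (unit_itv c).
Proof.
move=> i j _ _ [t [[/= ti _] [/= tj _]]]; rewrite !in_itv/= in ti tj.
by rewrite -(Num.Theory.truncn_def ti) (Num.Theory.truncn_def tj).
Qed.

Lemma unit_itv0 k : unit_itv 0 k = `[k%:R, k.+1%:R[%classic.
Proof.
apply/seteqP; split => [t []//|t kt]; split => //=.
move: kt; rewrite /= !in_itv/= andbT => /andP[kt _].
by rewrite (le_trans _ kt).
Qed.

Lemma lebesgue_unit_itv_le c k : (lebesgue_measure (unit_itv c k) <= 1)%E.
Proof.
apply: (@le_trans _ _ (lebesgue_measure (`[k%:R, k.+1%:R[%classic : set R))).
  apply: le_measure; rewrite ?inE; last exact: subIsetl.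
    exact: (measurable_unit_itv c k).
  exact: (measurable_itv `[k%:R, k.+1%:R[).
rewrite lebesgue_measure_itv/= lte_fin ltr_nat ltnSn -EFinB lee_fin.
by rewrite -natr1 addrAC subrr add0r.
Qed.

End UnitIntervals.

(** * Choquet integrals against sums of level contents *)

Section Choquet.
Variables (R : realType) (d : nat) (beta : R) (a : 'rV[R]_d) (l : R).
Local Notation H := (Defs.content beta a l).
Implicit Types (A : set 'rV[R]_d) (f : 'rV[R]_d -> R).
Local Open Scope ereal_scope.

Let g A f (t : R) := H [set x | A x /\ (t < f x)%R].

Let g_ge0 A f t : 0 <= g A f t. Proof. exact: dcontent_ge0. Qed.

Let g_anti A f : {homo g A f : x y / (x <= y)%R >-> y <= x}.
Proof.
by move=> s t st; apply: le_dcontent => x [Ax tx]; split => //; exact: le_lt_trans tx.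
Qed.

Let mg A f (D : set R) : measurable D -> measurable_fun D (g A f).
Proof. by move=> mD; apply: nonincreasing_emeasurable => //; exact: g_anti. Qed.

(** Chebyshev's inequality: [E] lies in every superlevel set of height below [c]. *)
Lemma choquet_ge_cst A f E c : (0 <= c)%R ->
  (forall x, E x -> A x /\ (c <= f x)%R) ->
  c%:E * H E <= choquet beta a l A f.
Proof.
move=> c0 EA; rewrite /choquet.
have mc : measurable (`[0%R, c[%classic : set R) by exact: measurable_itv.
apply: (@le_trans _ _ (\int[lebesgue_measure]_(t in `[0%R, c[) g A f t)); last first.
  apply: ge0_subset_integral => //; first by apply: mg.
  by move=> t/=; rewrite !in_itv/= andbT => /andP[].
apply: (@le_trans _ _ (\int[lebesgue_measure]_(t in `[0%R, c[) H E)).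
  rewrite integral_cst//= lebesgue_measure_itv/= lte_fin.
  rewrite muleC lee_wpmul2l ?dcontent_ge0//.
  by case: ltP => [_|]; rewrite -?EFinB ?subr0.
apply: ge0_le_integral => //.
- by move=> *; exact: dcontent_ge0.
- by apply: mg.
- move=> t/=; rewrite in_itv/= => /andP[t0 tc].
  by apply: le_dcontent => x /EA[Ax cx]; split => //; exact: lt_le_trans cx.
Qed.

(** Superlevel sets shrink with the height, so on each unit slice the integrand is at least its
    value at the right end. *)
Lemma choquet_ge_levels f :
  \sum_(k <oo) H [set x | (k.+1%:R < f x)%R] <= choquet beta a l setT f.
Proof.
rewrite /choquet -(bigcup_unit_itv (lexx 0%R)).
rewrite ge0_integral_bigcup//; last 4 first.
- by move=> k; exact: measurable_unit_itv.
- by apply: mg; apply: bigcup_measurable => k _; exact: measurable_unit_itv.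
- by move=> *; exact: g_ge0.
- exact: trivIset_unit_itv.
apply: lee_nneseries => k _; first by move=> _; exact: dcontent_ge0.
rewrite unit_itv0.
apply: (@le_trans _ _ (\int[lebesgue_measure]_(t in `[k%:R, k.+1%:R[)
    H [set x | (k.+1%:R < f x)%R])).
  rewrite integral_cst//= lebesgue_measure_itv/= lte_fin ltr_nat ltnSn -EFinB.
  by rewrite -natr1 addrAC subrr add0r mule1.
apply: ge0_le_integral => //.
- by move=> *; exact: dcontent_ge0.
- by apply: mg.
- move=> t/=; rewrite in_itv/= => /andP[_ tk].
  by apply: le_dcontent => x /= kx; split => //; exact: lt_trans kx.
Qed.

(** The heights, not the function, are split at [c]: below, superlevel sets are bounded by [A];
    above, by [E k] on slices of length at most 1. *)
Lemma choquet_le_levels A f E (c M : R) : (0 <= c)%R -> H A <= M%:E ->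
  (forall k x t, (k%:R <= t < k.+1%:R)%R -> (c <= t < f x)%R -> A x -> E k x) ->
  choquet beta a l A f <= (c * M)%:E + \sum_(k <oo) H (E k).
Proof.
move=> c0 AM AE; rewrite /choquet.
have mc : measurable (`[0%R, c[%classic : set R) by exact: measurable_itv.
have mcy : measurable (`[c, +oo[%classic : set R) by exact: measurable_itv.
have -> : `[0%R, +oo[%classic = `[0%R, c[%classic `|` `[c, +oo[%classic :> set R.
  apply/seteqP; split => t/=; rewrite !in_itv/= !andbT.
    by move=> ->; case: ltP; [left|right].
  by move=> [/andP[]|]//; exact: le_trans.
rewrite ge0_integral_setU//; last 3 first.
- exact: (@mg A f _ (measurableU _ _ mc mcy)).
- by move=> *; exact: g_ge0.
- apply/disj_setPS => t [/=]; rewrite !in_itv/= andbT => /andP[_ tc].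
  by rewrite leNgt tc.
apply: leeD.
  apply: (@le_trans _ _ (\int[lebesgue_measure]_(t in `[0%R, c[) M%:E)).
    apply: ge0_le_integral => //; [by move=> *; exact: g_ge0|by apply: mg|].
    by move=> t _; apply: le_trans AM; apply: le_dcontent => x [].
  rewrite integral_cst//= lebesgue_measure_itv/= lte_fin.
  case: ltP => [_|c0']; first by rewrite -EFinB subr0 -EFinM mulrC.
  by have -> : c = 0%R; [apply/eqP; rewrite eq_le c0 c0'|rewrite mule0 mul0r].
rewrite -(bigcup_unit_itv c0) ge0_integral_bigcup//; last 4 first.
- by move=> k; exact: measurable_unit_itv.
- by apply: mg; rewrite bigcup_unit_itv.
- by move=> *; exact: g_ge0.
- exact: trivIset_unit_itv.
apply: lee_nneseries => k _.
  by move=> _; apply: integral_ge0 => *; exact: g_ge0.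
have mk := measurable_unit_itv c k.
apply: (@le_trans _ _ (\int[lebesgue_measure]_(t in unit_itv c k) H (E k))).
  apply: ge0_le_integral => //; [by move=> *; exact: g_ge0|by apply: mg|].
  move=> t []/=; rewrite !in_itv/= andbT => tk ct.
  by apply: le_dcontent => x [Ax tx]; apply: (AE k x t) => //; rewrite ct.
rewrite integral_cst//= -[leRHS]mule1 lee_wpmul2l ?dcontent_ge0//.
exact: lebesgue_unit_itv_le.
Qed.

End Choquet.

(** * Null sets of the content are Hausdorff null *)

Section HausdorffNull.
Variables (R : realType) (d : nat) (beta : R) (a : 'rV[R]_d) (l : R).
Hypotheses (beta_gt0 : 0 < beta) (l_gt0 : 0 < l).

Lemma diam_dcube j m :
  0 <= Defs.diam (dcube a l j m) /\ Defs.diam (dcube a l j m) <= dside l j.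
Proof.
have x0 := dcube_corner a l_gt0 j m; set x := (X in dcube _ _ _ _ X) in x0.
set D := [set r | exists x y, dcube a l j m x /\ dcube a l j m y /\ r = `|x - y|].
have D0 : D 0 by exists x, x; rewrite subrr normr0.
have Dub : ubound D (dside l j).
  by move=> _ [y [z [cy [cz ->]]]]; exact: dcube_dist cy cz.
split; last by apply: ge_sup => //; exists 0.
by apply: ub_le_sup => //; exists (dside l j).
Qed.

Lemma diam_dcover_le c :
  (((Defs.diam (dcover a l c)) `^ beta)%:E <= dcost beta l c)%E.
Proof.
case: c => [[j m]|] /=; rewrite lee_fin.
  have [d0 dle] := diam_dcube j m.
  by rewrite ge0_ler_powR ?nnegrE// ltW// dside_gt0.
(* For [None], the [sup] of the empty set is 0, and so is 0 to the positive power [beta]. *)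
rewrite /Defs.diam (_ : [set _ | _] = set0) ?sup0 ?powR0 ?gt_eqF//.
by apply/seteqP; split => // r [x [y []]].
Qed.

(** A cover of small total cost consists of small cubes, so the mesh restriction in the Hausdorff
    measure comes for free. *)
Lemma hausdorff_null (N : set 'rV[R]_d) :
  Defs.content beta a l N = 0%E -> hausdorff beta N = 0%E.
Proof.
move=> N0; apply/eqP; rewrite eq_le; apply/andP; split; last first.
  apply: (@le_trans _ _ (hausdorff_delta beta 1 N)).
    apply/ereal_infP => _ [U [_ [_ ->]]]; apply: nneseries_ge0 => i _ _.
    by rewrite lee_fin powR_ge0.
  by apply: ereal_sup_ubound; exists 1 => //=; exact: ltr01.
apply: ge_ereal_sup => _ [e /= e0 <-]; apply/lee_addgt0Pr => r r0; rewrite add0e.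
(* [r] bounds the total cost; the other bound forces every side of the cover to be at most [e]. *)
pose t := Num.min r (e `^ beta).
have t0 : 0 < t by rewrite lt_min r0 powR_gt0.
have : (Defs.content beta a l N < t%:E)%E by rewrite N0 lte_fin.
move=> /ereal_inf_lt[_ [c [Nc ->]] ct].
have c0 i : (0 <= dcost beta l (c i))%E by exact: dcost_ge0.
apply: (@le_trans _ _ (\sum_(i <oo) ((Defs.diam (dcover a l (c i))) `^ beta)%:E)%E).
  apply: ereal_inf_lbound; exists (fun i => dcover a l (c i)); split => //; split => //.
  move=> i x y; have : (dcost beta l (c i) < t%:E)%E.
    apply: le_lt_trans ct; rewrite (@nneseriesD1 _ _ i)// leeDl//.
    by apply: nneseries_ge0.
  case: (c i) => [[j m]|//] /=; rewrite lte_fin lt_min => /andP[_ se] cx cy.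
  apply: le_trans (dcube_dist l_gt0 cx cy) _; rewrite leNgt; apply/negP => es.
  have s0 := dside_gt0 l_gt0 j.
  by move: se; rewrite ltNge ge0_ler_powR ?nnegrE// ltW.
apply: (@le_trans _ _ (\sum_(i <oo) dcost beta l (c i))%E).
  apply: lee_nneseries => i _; first by rewrite lee_fin powR_ge0.
  exact: diam_dcover_le.
by apply/ltW/(lt_le_trans ct); rewrite lee_fin ge_min lexx.
Qed.

End HausdorffNull.

(** * From estimates on small cubes to the limsup *)

Section Limsup.
Variables (R : realType) (d : nat) (beta : R) (a : 'rV[R]_d) (l : R).
Hypothesis l_gt0 : 0 < l.
Variables (f : 'rV[R]_d -> R) (x : 'rV[R]_d) (M delta : R).
Hypothesis delta_gt0 : 0 < delta.

Let sb_gt0 j : 0 < dside l j `^ beta. Proof. by rewrite powR_gt0// dside_gt0. Qed.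

Lemma dyadic_limsup_le :
  (forall j m, dcube a l j m x -> (dside l j < delta)%R ->
    choquet beta a l (dcube a l j m) f <= (M * dside l j `^ beta)%R%:E)%E ->
  (dyadic_limsup beta a l f x <= M%:E)%E.
Proof.
move=> le_M; apply: ge_ereal_inf; eexists; first by exists delta; split.
apply: ge_ereal_sup => _ [j [m [xjm [sd ->]]]].
by rewrite muleC lee_pdivrMr// -EFinM; exact: le_M.
Qed.

(** At every scale some dyadic cube contains [x], so the supremum is never over the empty set. *)
Lemma dyadic_limsup_ge :
  (forall j m, dcube a l j m x -> (dside l j < delta)%R ->
    (M * dside l j `^ beta)%R%:E <= choquet beta a l (dcube a l j m) f)%E ->
  (M%:E <= dyadic_limsup beta a l f x)%E.
Proof.
move=> ge_M; apply/ereal_infP => _ [e [e0 ->]].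
have [|j] := @dside_small _ l (Num.min e delta); first by rewrite lt_min e0.
rewrite lt_min => /andP[je jdelta]; have [m xm] := dcube_exists a l_gt0 x j.
apply: le_ereal_sup_tmp; eexists; first by exists j, m.
by rewrite muleC lee_pdivlMr// -EFinM; exact: ge_M.
Qed.

End Limsup.

(** * Two-sided estimate off the heavy cubes *)

Section LimsupApprox.
Import numFieldNormedType.Exports.
Variables (R : realType) (d : nat) (beta : R) (a : 'rV[R]_d) (l : R).
Hypotheses (beta_gt0 : 0 < beta) (beta_le : beta <= d%:R) (l_gt0 : 0 < l).
Variable f : 'rV[R]_d -> R.
Hypotheses (f_L1 : L1content beta a l f) (f_ge0 : forall x, 0 <= f x).
Local Notation H := (Defs.content beta a l).

(** Integrability makes the level contents summable, by [choquet_ge_levels]; this is a tail of that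
    series. *)
Lemma small_tail (s : R) : 0 < s -> exists K : nat,
  (\sum_(k <oo) H [set x | ((k + K).+1%:R < f x)%R] < s%:E)%E.
Proof.
move=> s0; have choquet_f : (choquet beta a l setT f < +oo)%E.
  case: f_L1 => _; rewrite (_ : (fun x => `|f x|) = f)//.
  by apply/funext => x; rewrite ger0_norm.
pose u k := H [set x | k.+1%:R < f x].
have u0 k : true -> (0 <= u k)%E by move=> _; exact: dcontent_ge0.
have ufin : (\sum_(k <oo) u k < +oo)%E.
  exact: le_lt_trans (choquet_ge_levels beta a l f) choquet_f.
have tail := nneseries_tail_cvg ufin u0.
have [K _ /(_ K (leqnn _))] : \forall K \near \oo, (\sum_(K <= k <oo) u k < s%:E)%E.
  apply: (tail [set y | (y < s%:E)%E]); apply: open_nbhs_nbhs.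
  by split; [exact: open_ereal_lt_ereal|rewrite /= lte_fin].
rewrite /= -nneseries_addn; last by move=> k; exact: u0.
by move=> tK; exists K.
Qed.

Lemma continuous_compl (O : set 'rV[R]_d) x e : {within ~` O, continuous f} ->
  ~ O x -> 0 < e -> exists2 delta, 0 < delta &
    forall y, ~ O y -> `|x - y| < delta -> `|f x - f y| < e.
Proof.
move=> /subspace_continuousP cf Ux e0.
have /cvgrPdist_lt/(_ _ e0) := cf x Ux.
rewrite /within/= => /nbhs_normP[delta delta0 hd].
by exists delta => // y Oy xy; apply: hd.
Qed.

(** [sigma] is independent of [lam], so the exceptional set can be made small at any fixed
    accuracy. *)
Lemma dyadic_limsup_approx (lam sigma : R) : 0 < lam -> lam < 1 -> 0 < sigma ->
  exists2 B, (H B <= (sigma / lam)%R%:E)%E & forall x, ~ B x ->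
    ((f x - lam * (1 + f x))%R%:E <= dyadic_limsup beta a l f x)%E /\
    (dyadic_limsup beta a l f x <= (f x + 2 * lam)%R%:E)%E.
Proof.
move=> lam0 lam1 sigma0.
have [K tailK] := small_tail (divr_gt0 sigma0 (ltr0n R 2)).
(* [U] will occur [K.+1] times among the [E k], hence this share of [sigma / 2]. *)
have [U [_ [HU fU]]] := f_L1.1 _ (divr_gt0 sigma0 (ltr0n R (K.+1 * 2))).
(* The bound [K.+1] puts [U] at index 0 even when [K = 0]; [Ux] and [HU1] rely on this. *)
pose E k := if (k < K.+1)%N then U else [set x | k%:R < f x].
have HE : (\sum_(k <oo) H (E k) < sigma%:E)%E.
  rewrite (nneseries_split 0 K.+1); last by move=> *; exact: dcontent_ge0.
  have half : (\sum_(0 <= k < 0 + K.+1) H (E k) <= (sigma / 2)%:E)%E.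
    apply: (@le_trans _ _ (\sum_(0 <= k < K.+1) (sigma / (K.+1 * 2)%:R)%:E)%E).
      rewrite add0n !big_nat; apply: lee_sum => k /andP[_ kK].
      by rewrite /E kK ltW.
    rewrite sumEFin big_const_nat subn0 iter_addr_0 lee_fin -(mulr_natr _ K.+1) natrM.
    have : K.+1%:R != 0 :> R by rewrite pnatr_eq0.
    by move: K.+1%:R => c c0; rewrite le_eqVlt; apply/predU1P; left; field.
  have -> : sigma = sigma / 2 + sigma / 2 by lra.
  rewrite EFinD; apply: lee_ltD => //.
    rewrite ge0_fin_numE; first exact: le_lt_trans half (ltry _).
    by apply: sume_ge0 => *; exact: dcontent_ge0.
  rewrite add0n -nneseries_addn; last by move=> *; exact: dcontent_ge0.
  apply: le_lt_trans tailK; apply: lee_nneseries => k _.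
    by move=> _; exact: dcontent_ge0.
  by rewrite /E ltnNge leq_addl /= addnS.
have [P [EP Psum]] := dcontent_covers HE.
exists [set x | exists j m, dcube a l j m x /\ heavy beta a l P lam j m].
  exact: (@dcontent_heavy _ d beta a l beta_gt0 l_gt0 _ P sigma lam lam0 (ltW Psum)).
move=> x Bx.
(* As [lam < 1], every cube of the family is itself heavy. *)
have xP p q : P p = Some q -> ~ dcube a l q.1 q.2 x.
  move=> Pp qx; apply: Bx; exists q.1, q.2; split => //; rewrite /heavy.
  apply: (@lt_le_trans _ _ ((dside l q.1) `^ beta)%R%:E).
    by rewrite lte_fin gtr_pMl// powR_gt0// dside_gt0.
  apply: (@le_trans _ _ (\esum_(p in [set p]) dcost beta l (P p))).
    by rewrite esum_set1 ?dcost_ge0// Pp.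
  rewrite esum_mkcond [leRHS]esum_mkcond; apply: le_esum => p' _.
  case: ifPn => [|_]; last by case: ifP => // _; exact: dcost_ge0.
  by rewrite inE => ->; rewrite mem_set//; exists q.
have Ux : ~ U x.
  move=> Ux; have [i _] : (\bigcup_i dcover a l (P (0%N, i))) x by exact: EP.
  by case E1 : (P (0%N, i)) => [q|//]; exact: xP E1.
have light j m : dcube a l j m x ->
    (\sum_(k <oo) H (dcube a l j m `&` E k) <= (lam * dside l j `^ beta)%R%:E)%E.
  move=> xjm; have : ~ heavy beta a l P lam j m.
    by move=> hjm; apply: Bx; exists j, m.
  move/negP; rewrite /heavy -leNgt; apply: le_trans.
  rewrite nneseries_esumT; last by move=> *; exact: dcontent_ge0.
  rewrite [leRHS]esum_mkcond.
  have -> : [set: nat * nat] = [set: nat] `*`` (fun=> [set: nat]).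
    by apply/seteqP; split.
  pose c k i := if (k, i) \in inside a l P j m then P (k, i) else None.
  rewrite [leRHS](_ : _ = \esum_(p in [set: nat] `*`` (fun=> [set: nat]))
      dcost beta l (c p.1 p.2)); last first.
    by apply: eq_esum => -[k i] _; rewrite /c; case: ifP.
  rewrite -(@esum_esum R nat nat _ _ (fun k i => dcost beta l (c k i))); last first.
    by move=> *; exact: dcost_ge0.
  apply: le_esum => k _; apply: dcontent_le_esum => y [yjm /EP[i _ yi]].
  exists i => //; rewrite /c; case: ifPn => //; rewrite notin_setE => out.
  exfalso; case Pq : (P (k, i)) yi => [q|//] /= qy.
  (* A family cube meeting the given cube lies inside it or contains it; the latter would put [x] in
     a family cube. *)
  case: (leP j q.1) => jq.
    by apply: out; exists q => //; exact: (dcube_nested l_gt0 jq yjm qy).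
  by apply: (xP _ _ Pq); exact: (dcube_nested l_gt0 (ltW jq) qy yjm).
have [delta delta0 near_x] := continuous_compl fU Ux lam0.
have sb0 j : 0 < dside l j `^ beta by rewrite powR_gt0// dside_gt0.
have close j m y : dcube a l j m x -> dside l j < delta -> dcube a l j m y ->
    ~ U y -> `|f x - f y| < lam.
  by move=> xm sd ym Uy; apply: near_x => //; apply: le_lt_trans sd; exact: dcube_dist xm ym.
split; last first.
  apply: (dyadic_limsup_le l_gt0 delta0) => j m xm sd.
  (* Off [U] the values in this small cube stay below [f x + lam], so above that height the low
     slices see only [U]. *)
  apply: le_trans (@choquet_le_levels _ _ beta a l _ f (fun k => dcube a l j m `&` E k)
    (f x + lam) (dside l j `^ beta) _ _ _) _.
  - by rewrite addr_ge0// ltW.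
  - exact: dcontent_dcube_le.
  - move=> k y t /andP[kt _] /andP[ct ty] ym; split => //; rewrite /E.
    case: ifPn => _; last exact: le_lt_trans kt ty.
    apply: contrapT => Uy; have := close j m y xm sd ym Uy.
    by rewrite ltr_norml => /andP[+ _]; rewrite ltrBrDr; lra.
  - apply: le_trans (leeD (lexx _) (light j m xm)) _.
    by rewrite -EFinD lee_fin; move: (sb0 j); lra.
apply: (dyadic_limsup_ge (f := f) l_gt0 delta0) => j m xm sd.
(* In the first case the claimed lower bound is nonpositive; in the second [f x - lam] is an
   admissible height for [choquet_ge_cst]. *)
have [fx_lt|fx_ge] := ltP (f x) lam.
  apply: (@le_trans _ _ 0%E); last by apply: integral_ge0 => *; exact: dcontent_ge0.
  rewrite lee_fin pmulr_lle0//; have := f_ge0 x; nra.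
have HU1 : (H (dcube a l j m `&` U) <= (lam * dside l j `^ beta)%R%:E)%E.
  apply: le_trans (light j m xm).
  rewrite (@nneseriesD1 _ _ 0%N)//; last by move=> *; exact: dcontent_ge0.
  by rewrite leeDl//; apply: nneseries_ge0 => *; exact: dcontent_ge0.
(* Subadditivity of [H] and the exact content of the cube turn smallness of the part in [U] into
   largeness of the rest. *)
have HU2 : (((1 - lam) * dside l j `^ beta)%R%:E <= H (dcube a l j m `\` U))%E.
  rewrite mulrBl mul1r EFinB leeBlDr//.
  rewrite -(dcontent_dcube a beta_gt0 beta_le l_gt0 j m).
  apply: (@le_trans _ _ (H ((dcube a l j m `\` U) `|` (dcube a l j m `&` U)))).
    by apply: le_dcontent => y ym; case: (pselect (U y)); [right|left].
  by apply: le_trans (dcontentU _ _ _ _ _) _; rewrite leeD2l.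
apply: le_trans (@choquet_ge_cst _ _ beta a l _ f
  (dcube a l j m `\` U) (f x - lam) _ _); last 2 first.
- by rewrite subr_ge0.
- move=> y [ym Uy]; split => //; have := close j m y xm sd ym Uy.
  by rewrite ltr_norml => /andP[_]; lra.
have fxlam : (0 <= (f x - lam)%:E)%E by rewrite lee_fin subr_ge0.
apply: le_trans (lee_wpmul2l fxlam HU2).
rewrite -EFinM lee_fin mulrA ler_wpM2r ?(ltW (sb0 j))//.
(* The two sides differ by the square of [lam]. *)
nra.
Qed.

End LimsupApprox.

(** * Letting [lam] tend to 0 *)

Theorem theorem3p3 (R : realType) (d : nat) (beta : R) (a : 'rV[R]_d) (l : R)
    (f : 'rV[R]_d -> R) :
  0 < beta -> beta <= d%:R -> 0 < l ->
  L1content beta a l f -> (forall x, 0 <= f x) ->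
  exists N : set 'rV[R]_d, hausdorff beta N = 0%E /\
    forall x, ~ N x -> dyadic_limsup beta a l f x = (f x)%:E.
Proof.
move=> beta_gt0 beta_le l_gt0 f_L1 f_ge0.
(* The exceptional set itself is taken, since the sets [B n] below depend on [e]. *)
pose N := [set x | dyadic_limsup beta a l f x <> (f x)%:E].
exists N; split; last by move=> x /contrapT.
apply: (hausdorff_null (a := a) beta_gt0 l_gt0).
apply/eqP; rewrite eq_le dcontent_ge0 andbT.
apply/lee_addgt0Pr => e e0; rewrite add0e.
(* Shifted by two so that [lam n < 1] already at [n = 0]. *)
pose lam n : R := n.+2%:R^-1.
have lam0 n : 0 < lam n by rewrite invr_gt0 ltr0n.
have lam1 n : lam n < 1 by rewrite invf_lt1 ?ltr0n// ltr1n.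
(* With this [sigma], the factor [lam n] cancels in [sigma / lam], leaving errors that sum to
   [e]. *)
have sigma0 n : 0 < lam n * (e / (2 ^ n.+1)%:R).
  by rewrite mulr_gt0// divr_gt0// ltr0n expn_gt0.
have ex n : exists B,
    (Defs.content beta a l B <= (e / (2 ^ n.+1)%:R)%:E)%E /\
    forall x, ~ B x ->
      ((f x - lam n * (1 + f x))%R%:E <= dyadic_limsup beta a l f x)%E /\
      (dyadic_limsup beta a l f x <= (f x + 2 * lam n)%R%:E)%E.
  have [B HB fB] := dyadic_limsup_approx beta_gt0 beta_le l_gt0 f_L1 f_ge0
    (lam0 n) (lam1 n) (sigma0 n).
  by exists B; split => //; move: HB; rewrite mulrC mulKf ?gt_eqF.
have [B BP] := choice ex.
have NB : N `<=` \bigcup_n B n.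
  move=> x; apply: contra_notP => nB.
  have {}nB n : ~ B n x by move=> Bx; apply: nB; exists n.
  have small r : 0 < r -> exists n, (1 + f x) * lam n < r /\ 2 * lam n < r.
    (* [3 + f x] dominates both [1 + f x] and [2]. *)
    move=> r0; pose C := (3 + f x) / r.
    have C0 : 0 < C by rewrite divr_gt0// ltr_wpDr.
    exists (Num.truncn C); have := Num.Theory.truncnS_gt C.
    set n := Num.truncn C => Cn; have {}Cn : C < n.+2%:R.
      by apply: lt_trans Cn _; rewrite ltr_nat.
    rewrite /lam !ltr_pdivrMr ?ltr0n//.
    move: Cn; rewrite ltr_pdivrMr// => Cn; have := f_ge0 x; split; lra.
  apply/eqP; rewrite eq_le; apply/andP; split.
    apply/lee_addgt0Pr => r r0; have [n [_ nr]] := small r r0.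
    apply: le_trans ((BP n).2 x (nB n)).2 _.
    by rewrite -EFinD lee_fin lerD2l ltW.
  apply/lee_subgt0Pr => r r0; have [n [nr _]] := small r r0.
  apply: le_trans ((BP n).2 x (nB n)).1.
  by rewrite -EFinB lee_fin lerB// mulrC ltW.
apply: le_trans (le_dcontent _ _ _ NB) _; apply: le_trans (dcontent_bigcup _ _ _ _) _.
apply: le_trans (epsilon_trick0 xpredT (ltW e0)).
apply: lee_nneseries => n _; first by move=> _; exact: dcontent_ge0.
exact: (BP n).1.
Qed.
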